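(* Let $f\colon X\to Y$ be a visual function of proper $\delta$-hyperbolic geodesic spaces. If $f$ is coarsely surjective, then the induced map $\tilde f\colon\partial X\to\partial Y$ is surjective.
   Context: For a metric space $(X,d)$ and $a,x,y\in X$ the Gromov product is $(x,y)_a=\frac12\big(d(x,a)+d(y,a)-d(x,y)\big)$. $X$ is $\delta$-hyperbolic if $(x,y)_{x_0}\ge \min\{(x,z)_{x_0},(z,y)_{x_0}\}-\delta/4$ for all $x,y,z,x_0\in X$. Proper means that closed balls are compact. The boundary $\partial X$ of a proper hyperbolic geodesic space $X$ with basepoint $a$ is the set of sequences $(x_n)$ in $X$ with $\liminf_{i,j\to\infty}(x_i,x_j)_a=\infty$, modulo $(x_n)\sim(y_n)$ iff $\liminf_{i,j\to\infty}(x_i,y_j)_a=\infty$. $f\colon X\to Y$ is large scale Lipschitz if there are $\lambda_1,\mu_1>0$ with $d(f(x),f(y))\le\lambda_1 d(x,y)+\mu_1$ for all $x,y$. A large scale Lipschitz $f$ is visual if for some (equivalently every) $a\in X$, for all sequences, $(x_n,y_n)_a\to\infty$ implies $(f(x_n),f(y_n))_{f(a)}\to\infty$. A visual function induces the well-defined map $\tilde f\colon\partial X\to\partial Y$, $\tilde f([(x_n)])=[(f(x_n))]$. $f$ is coarsely surjective if there is $S$ such that for every $y\in Y$ there is $x\in X$ with $d(f(x),y)\le S$. *)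

(* Defs.v *)
From HB Require Import structures.
From mathcomp Require Import all_boot all_order all_algebra generic_quotient.
From mathcomp Require Import all_classical all_reals all_analysis.
From mathcomp Require Import lra.

Set Implicit Arguments.
Unset Strict Implicit.
Unset Printing Implicit Defensive.

Import Order.TTheory GRing.Theory Num.Theory.
Import numFieldNormedType.Exports.

Local Open Scope classical_set_scope.
Local Open Scope quotient_scope.
Local Open Scope ring_scope.

Section spaces.
Context {R : realType} {X : metricType R}.
Implicit Types (a x y : X) (u v w : nat -> X).

Definition gromov_product a x y : R :=
  (mdist x a + mdist y a - mdist x y) / 2.

Definition hyperbolic (delta : R) : Prop :=
  forall x y z x0 : X,
    gromov_product x0 x y >=
      Num.min (gromov_product x0 x z) (gromov_product x0 z y) - delta / 4.

(* The library's [closed_ball] is the closure of the open ball, which in a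
   general metric space can be smaller than this set. *)
Definition proper_space : Prop :=
  forall x (r : R), compact [set y : X | mdist x y <= r].

Definition geodesic_space : Prop :=
  forall x y : X, exists gamma : R -> X,
    [/\ gamma 0 = x, gamma (mdist x y) = y &
        forall s t, s \in `[0, mdist x y] -> t \in `[0, mdist x y] ->
          mdist (gamma s) (gamma t) = `|s - t|].

(* The liminf of (u_i, v_j)_a over i, j -> oo, as an extended real. *)
Definition liminf_gromov a u v : \bar R :=
  limf_einf (fun ij : nat * nat => (gromov_product a (u ij.1) (v ij.2))%:E)
    (filter_prod \oo \oo).

Lemma liminf_gromovP a u v :
  liminf_gromov a u v = +oo%E <->
  forall M : R, exists N : nat, forall i j, (N <= i)%N -> (N <= j)%N ->
    M <= gromov_product a (u i) (v j).
Proof.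
rewrite /liminf_gromov limf_einfE; split=> [h M|h].
  have : (M%:E < +oo :> \bar R)%E by rewrite ltry.
  rewrite -h => /ereal_sup_gt [_ [V FV <-]] MV.
  case: FV => -[A B] /= [[N1 _ hA] [N2 _ hB]] sub.
  exists (maxn N1 N2) => i j; rewrite !geq_max => /andP[i1 _] /andP[_ j2].
  rewrite -lee_fin (le_trans (ltW MV))//; apply: ereal_inf_lbound.
  by exists (i, j) => //; apply: sub; split; [exact: hA|exact: hB].
apply: eq_infty => M.
have [N hN] := h M.
pose V := [set ij : nat * nat | (N <= ij.1)%N /\ (N <= ij.2)%N].
apply: (@le_trans _ _ (ereal_inf
    ((fun ij => (gromov_product a (u ij.1) (v ij.2))%:E) @` V))).
  by apply: le_ereal_inf_tmp => _ [[i j] [/= Ni Nj] <-]; rewrite lee_fin hN.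
apply: ereal_sup_ubound; exists V => //.
exists ([set i | (N <= i)%N], [set i | (N <= i)%N]) => //=.
by split; exists N.
Qed.

Lemma gromov_product_sym a x y : gromov_product a x y = gromov_product a y x.
Proof. by rewrite /gromov_product (metric_sym x y) [mdist x a + _]addrC. Qed.

Lemma gromov_product_base a b x y :
  gromov_product a x y - mdist a b <= gromov_product b x y.
Proof.
have := metric_triangle x b a; have := metric_triangle y b a.
rewrite /gromov_product (metric_sym b a); lra.
Qed.

Lemma liminf_gromov_sym a u v :
  liminf_gromov a u v = +oo%E -> liminf_gromov a v u = +oo%E.
Proof.
move=> /liminf_gromovP h; apply/liminf_gromovP => M.
have [N hN] := h M; exists N => i j Ni Nj.
by rewrite gromov_product_sym hN.
Qed.

Lemma liminf_gromov_trans delta (hX : hyperbolic delta) a u v w :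
  liminf_gromov a u v = +oo%E -> liminf_gromov a v w = +oo%E ->
  liminf_gromov a u w = +oo%E.
Proof.
move=> /liminf_gromovP h1 /liminf_gromovP h2; apply/liminf_gromovP => M.
have [N1 hN1] := h1 (M + delta / 4); have [N2 hN2] := h2 (M + delta / 4).
exists (maxn N1 N2) => i j; rewrite !geq_max => /andP[i1 i2] /andP[j1 j2].
apply: le_trans (hX (u i) (w j) (v (maxn N1 N2)) a).
by rewrite lerBrDr le_min hN1 ?hN2 ?leq_maxl ?leq_maxr.
Qed.

Definition gromov_seq a := {u : nat -> X | `[< liminf_gromov a u u = +oo%E >]}.

HB.instance Definition _ a := Choice.on (gromov_seq a).

Definition gromov_equiv a (u v : gromov_seq a) : bool :=
  `[< liminf_gromov a (val u) (val v) = +oo%E >].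

Section boundary.
Variables (delta : R) (hX : hyperbolic delta) (a : X).

Lemma gromov_equiv_refl : reflexive (@gromov_equiv a).
Proof. by case. Qed.

Lemma gromov_equiv_sym : symmetric (@gromov_equiv a).
Proof. by move=> u v; apply/asboolP/asboolP => /liminf_gromov_sym. Qed.

Lemma gromov_equiv_trans : transitive (@gromov_equiv a).
Proof.
move=> v u w /asboolP uv /asboolP vw; apply/asboolP.
exact: liminf_gromov_trans hX _ _ _ _ uv vw.
Qed.

Definition gromov_equiv_rel : equiv_rel (gromov_seq a) :=
  EquivRel (@gromov_equiv a) gromov_equiv_refl gromov_equiv_sym
    gromov_equiv_trans.

Definition boundary := {eq_quot gromov_equiv_rel}.

Lemma boundary_eqP (u v : gromov_seq a) :
  \pi_boundary u = \pi_boundary v <->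
  liminf_gromov a (val u) (val v) = +oo%E.
Proof.
split=> [|uv].
  by move/(@eqmodP _ gromov_equiv_rel)/asboolP.
by apply/(@eqmodP _ gromov_equiv_rel)/asboolP.
Qed.

End boundary.

End spaces.

Arguments hyperbolic {R} X delta.
Arguments proper_space {R} X.
Arguments geodesic_space {R} X.

Section maps.
Context {R : realType} {X Y : metricType R}.
Implicit Type f : X -> Y.

Definition large_scale_lipschitz f : Prop :=
  exists lambda1 mu1 : R, [/\ 0 < lambda1, 0 < mu1 &
    forall x y, mdist (f x) (f y) <= lambda1 * mdist x y + mu1].

Definition visual_at f (a : X) : Prop :=
  forall u v : nat -> X,
    gromov_product a (u n) (v n) @[n --> \oo] --> +oo ->
    gromov_product (f a) (f (u n)) (f (v n)) @[n --> \oo] --> +oo.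

Definition visual f : Prop :=
  large_scale_lipschitz f /\ exists a, visual_at f a.

Definition coarsely_surjective f : Prop :=
  exists S : R, forall y, exists x, mdist (f x) y <= S.

Lemma visual_liminf f (hf : visual f) a b (u v : nat -> X) :
  liminf_gromov a u v = +oo%E ->
  liminf_gromov b (f \o u) (f \o v) = +oo%E.
Proof.
case: hf => _ [c hc] /liminf_gromovP huv; apply/liminf_gromovP => M.
apply: contrapT => /forallNP hN.
have /choice[p hp] : forall N, exists p : nat * nat,
    [/\ (N <= p.1)%N, (N <= p.2)%N &
        gromov_product b (f (u p.1)) (f (v p.2)) < M].
  move=> N; have /existsNP[i /existsNP[j]] := hN N.
  move=> /not_implyP[Ni /not_implyP[Nj /negP]]; rewrite -ltNge => lt_M.
  by exists (i, j).
have cvgX : gromov_product c (u (p n).1) (v (p n).2) @[n --> \oo] --> +oo.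
  apply/cvgryPge => A.
  have [N hNA] := huv (A + mdist a c).
  exists N => // n /= Nn; have [n1 n2 _] := hp n.
  apply: le_trans (gromov_product_base a c _ _).
  by rewrite lerBrDr hNA // (leq_trans Nn).
have /cvgryPge/(_ (M + mdist (f c) b))[N _ /(_ N (leqnn N)) /=] := hc _ _ cvgX.
have [_ _] := hp N; rewrite ltNge => /negP + le_M; apply.
by apply: le_trans (gromov_product_base (f c) b _ _); rewrite lerBrDr.
Qed.

Section induced.
Variables (f : X -> Y) (hf : visual f) (deltaX deltaY : R).
Variables (hX : hyperbolic X deltaX) (hY : hyperbolic Y deltaY) (a : X) (b : Y).

Definition induced_seq (u : gromov_seq a) : gromov_seq b :=
  exist _ (f \o val u)
    (asboolT (visual_liminf hf b (asboolW (valP u)))).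

Definition induced_map : boundary hX a -> boundary hY b :=
  lift_fun1 (boundary hX a) (fun u => \pi_(boundary hY b) (induced_seq u)).

Lemma induced_mapE (u : gromov_seq a) :
  induced_map (\pi_(boundary hX a) u) = \pi_(boundary hY b) (induced_seq u).
Proof.
rewrite /induced_map; unlock; apply/boundary_eqP.
apply: (visual_liminf hf); apply/(boundary_eqP hX).
exact: reprK.
Qed.

End induced.

End maps.

Arguments induced_map {R X Y f} hf {deltaX deltaY} hX hY a b.

(* Main.v *)
(* Given a Gromov sequence y in Y, choose x_n with f(x_n) within S of y_n.  As f
   is large scale Lipschitz, x_n leaves every ball of X.  In a proper geodesic
   hyperbolic space such a sequence has a Gromov subsequence: for each radius k
   the points at distance k from a on geodesics [a, x_n] accumulate somewhere,
   so (x_n, x_m)_a >= k - C for all n, m in a large set of indices.  Working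
   along one ultrafilter on nat makes these sets compatible for all k, which
   replaces a diagonal argument.  The image of the subsequence is asymptotic
   to y. *)
Require Import Defs.
From mathcomp Require Import all_boot all_order all_algebra.
From mathcomp Require Import all_classical all_reals all_analysis.
From mathcomp Require Import lra.

Set Implicit Arguments.
Unset Strict Implicit.
Unset Printing Implicit Defensive.

Import Order.TTheory GRing.Theory Num.Theory.

Local Open Scope classical_set_scope.
Local Open Scope ring_scope.

Section gromov.
Context {R : realType} {X : metricType R}.
Implicit Types (a p q x y z : X).

Lemma gromov_product_lip a x y z :
  gromov_product a y z - mdist x y <= gromov_product a x z.
Proof.
have := metric_triangle y x a; have := metric_triangle x y z.
rewrite /gromov_product (metric_sym y x); lra.
Qed.

Lemma gromov_product_le_mdist a x y : gromov_product a x y <= mdist x a.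
Proof.
have := metric_triangle y x a.
rewrite /gromov_product (metric_sym y x); lra.
Qed.

Lemma hyperbolic_ge0 delta : hyperbolic X delta -> X -> 0 <= delta.
Proof. by move=> hX a; have := hX a a a a; rewrite minxx; lra. Qed.

(** Given [mdist p a = r], the second equation amounts to d(p,x) = d(a,x) - r: [p] lies between [a]
    and [x]. Geodesics are used below only in this form. *)
Lemma geodesic_point (gX : geodesic_space X) a x (r : R) :
  0 <= r <= mdist x a ->
  exists p, mdist p a = r /\ gromov_product a p x = r.
Proof.
move=> /andP[r0 rx]; have [g [g0 g1 gP]] := gX a x.
rewrite (metric_sym a x) in g1 gP.
have I0 : 0 \in `[0, mdist x a] by rewrite in_itv /= lexx mdist_ge0.
have I1 : mdist x a \in `[0, mdist x a] by rewrite in_itv /= lexx mdist_ge0.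
have Ir : r \in `[0, mdist x a] by rewrite in_itv /= r0 rx.
have gra : mdist (g r) a = r by rewrite -{1}g0 gP// subr0 ger0_norm.
have grx : mdist (g r) x = mdist x a - r.
  by rewrite -{1}g1 gP// distrC ger0_norm// subr_ge0.
by exists (g r); rewrite /gromov_product gra grx; split=> //; lra.
Qed.

(** Being near [q] puts [p] and [p'] within 2 of each other, so (p,p')_a >= r - 1. Hyperbolicity
    through [p'] and then through [p] costs delta/4 each time. *)
Lemma gromov_product_near (delta : R) (hX : hyperbolic X delta) a q x y p p'
    (r : R) :
  mdist p a = r -> gromov_product a p x = r ->
  mdist p' a = r -> gromov_product a p' y = r ->
  mdist q p < 1 -> mdist q p' < 1 ->
  r - 1 - delta / 2 <= gromov_product a x y.
Proof.
move=> pa px p'a p'y qp qp'.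
have d0 := hyperbolic_ge0 hX a.
have pp' : r - 1 <= gromov_product a p p'.
  have := metric_triangle p q p'.
  by rewrite /gromov_product pa p'a (metric_sym p q); lra.
have py : r - 1 - delta / 4 <= gromov_product a p y.
  apply: le_trans (hX p y p' a); rewrite lerB// le_min pp' p'y; lra.
apply: le_trans (hX x y p a).
rewrite lerBrDr le_min (gromov_product_sym a x p) px; apply/andP; split; lra.
Qed.

Lemma gromov_subsequence (delta : R) (hX : hyperbolic X delta)
    (pX : proper_space X) (gX : geodesic_space X) a (x : nat -> X) :
  mdist (x n) a @[n --> \oo] --> +oo ->
  exists s : nat -> nat, (forall n, (n <= s n)%N) /\
    liminf_gromov a (x \o s) (x \o s) = +oo%E.
Proof.
move=> /cvgryPge xoo.
have [U [UU ooU]] := ultraFilterLemma (eventually_filter : ProperFilter \oo).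
have /choice[A AP] : forall k : nat, exists A : set nat, U A /\
    forall m n, A m -> A n ->
      k%:R - 1 - delta / 2 <= gromov_product a (x m) (x n).
  move=> k.
  have /choice[p pP] : forall n, exists p, k%:R <= mdist (x n) a ->
      mdist p a = k%:R /\ gromov_product a p (x n) = k%:R.
    (* The value [a] is a dummy for [x n] closer than [k]; [Uk] discards these indices. *)
    move=> n; have [kn|kn] := leP k%:R (mdist (x n) a); last by exists a.
    have [|p pP] := @geodesic_point gX a (x n) k%:R; last by exists p.
    by rewrite ler0n.
  have Uk : U [set n | k%:R <= mdist (x n) a] by apply: ooU; exact: xoo.
  have pU : (p @ U) [set z | mdist a z <= k%:R].
    by apply: (@filterS _ U _ _ _ _ Uk) => n /= kn; rewrite metric_sym (pP n kn).1.
  have [q [_ qU]] := pX a k%:R (p @ U) _ pU.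
  (* An ultrafilter converges to its cluster points: otherwise the complement of the ball would be
     large and so would meet the ball. *)
  have pq : U (p @^-1` ball q 1).
    have [//|pNq] := in_ultra_setVsetC (p @^-1` ball q 1) UU.
    by have [z []] := qU (~` ball q 1) _ pNq (nbhsx_ballx q 1 ltr01).
  exists ([set n | k%:R <= mdist (x n) a] `&` p @^-1` ball q 1); split.
    exact: filterI.
  move=> m n [/= /pP[pma pmx]]; rewrite !ballEmdist /= => qm.
  by move=> [/pP[pna pnx] qn]; exact: (gromov_product_near hX) qm qn.
(* Finitely many [U]-large sets and a tail have a [U]-large, hence nonempty, intersection. Taking
   [A 0] to [A k] at stage [k] gives [A k (s i)] for all i >= k. *)
have /choice[s sP] : forall k, exists n,
    (k <= n)%N /\ forall j : 'I_k.+1, A j n.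
  move=> k; apply: (@filter_ex _ U); apply: filterI.
    by apply: ooU; exists k.
  by apply: filter_forall => j; have [] := AP j.
exists s; split=> [n|]; first by have [] := sP n.
apply/liminf_gromovP => M.
have [k kM] : exists k : nat, M + 1 + delta / 2 <= k%:R.
  by exists (Num.truncn (M + 1 + delta / 2)).+1; exact/ltW/truncnS_gt.
exists k => i j ki kj.
apply: (@le_trans _ _ (k%:R - 1 - delta / 2)); first lra.
have inA i' : (k <= i')%N -> A k (s i').
  by move=> ki'; have [_ /(_ (Ordinal (ki' : k < i'.+1)%N))] := sP i'.
by have [_] := AP k; apply; exact: inA.
Qed.

End gromov.

(** The Lipschitz bound read backwards: d(f(x_n),b) - d(f(a),b) <= l d(x_n,a) + mu. *)
Lemma large_scale_lipschitz_cvgy {R : realType} {X Y : metricType R}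
    (f : X -> Y) (a : X) (b : Y) (x : nat -> X) :
  large_scale_lipschitz f ->
  mdist (f (x n)) b @[n --> \oo] --> +oo -> mdist (x n) a @[n --> \oo] --> +oo.
Proof.
move=> [l [mu [l0 mu0 fl]]] /cvgryPge foo; apply/cvgryPge => M.
apply: filterS _ (foo (l * M + mu + mdist (f a) b)) => n /= Mn.
rewrite -(ler_pM2l l0).
have := fl (x n) a; have := metric_triangle (f (x n)) (f a) b; lra.
Qed.

Theorem theorem6p3 (R : realType) (X Y : metricType R) (delta : R)
    (hX : hyperbolic X delta) (hY : hyperbolic Y delta)
    (properX : proper_space X) (properY : proper_space Y)
    (geodesicX : geodesic_space X) (geodesicY : geodesic_space Y)
    (f : X -> Y) (hf : visual f) (a : X) (b : Y) :
  coarsely_surjective f ->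
  set_surj [set: boundary hX a] [set: boundary hY b] (induced_map hf hX hY a b).
Proof.
move=> [S fS] eta _.
pose y := repr eta; have yoo := asboolW (valP y).
have /choice[x xP] : forall n, exists p, mdist (f p) (val y n) <= S by [].
have xoo : mdist (x n) a @[n --> \oo] --> +oo.
  have [f_lip _] := hf; apply: (@large_scale_lipschitz_cvgy _ _ _ f a b x f_lip).
  (* d(f(x_n),b) >= (f(x_n),y_n)_b >= (y_n,y_n)_b - S. *)
  apply/cvgryPge => M; have [N hN] := (liminf_gromovP _ _ _).1 yoo (M + S).
  exists N => // n /= Nn; have := hN n n Nn Nn.
  have := gromov_product_lip b (f (x n)) (val y n) (val y n).
  have := gromov_product_le_mdist b (f (x n)) (val y n).
  have := xP n; lra.
have [s [sn soo]] := gromov_subsequence hX properX geodesicX xoo.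
pose u : gromov_seq a := exist _ (x \o s) (asboolT soo).
exists (\pi_(boundary hX a) u)%qT => //.
rewrite induced_mapE -[eta]reprK; apply/boundary_eqP/liminf_gromovP => M.
(* Replacing y_{s i} by f(x_{s i}) costs at most [S], and s i >= i keeps the index beyond [N]. *)
have [N hN] := (liminf_gromovP _ _ _).1 yoo (M + S).
exists N => i j Ni Nj /=; have := hN (s i) j (leq_trans Ni (sn i)) Nj.
have := gromov_product_lip b (f (x (s i))) (val y (s i)) (val y j).
have := xP (s i); rewrite /y /=; lra.
Qed.
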